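(* $\beta(\mathbb{Z}_2 \times \mathbb{Z}_2) = 4$ and $\beta(\mathbb{Z}_2^3) = 6$.
   Context: All posets are finite and non-empty. For a poset $P$, $\operatorname{Aut}(P)$ is the group of order-automorphisms of $P$ (bijections $P \to P$ that preserve the order and whose inverse preserves the order). For a finite group $G$, $\beta(G) := \min\{\,|P| : P \text{ is a finite non-empty poset with } \operatorname{Aut}(P) \cong G\,\}$. $\mathbb{Z}_n$ denotes the cyclic group of order $n$, and $\mathbb{Z}_2^3 = \mathbb{Z}_2 \times \mathbb{Z}_2 \times \mathbb{Z}_2$. *)

(* Defs.v *)
From mathcomp Require Import all_boot all_order all_fingroup all_algebra.
From mathcomp Require Import boolp classical_sets.

Set Implicit Arguments.
Unset Strict Implicit.
Unset Printing Implicit Defensive.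

Section PosetAut.
Variables (d : Order.disp_t) (P : finPOrderType d).

Definition order_preserving (f : P -> P) : bool :=
  [forall x, forall y, (x <= y)%O ==> (f x <= f y)%O].

Lemma order_preservingP (f : P -> P) :
  reflect {homo f : x y / (x <= y)%O} (order_preserving f).
Proof.
apply: (iffP forallP) => [H x y|H x].
  by move: (forallP (H x) y) => /implyP.
by apply/forallP => y; apply/implyP; apply: H.
Qed.

Definition poset_aut : {set {perm P}} :=
  [set s : {perm P} | order_preserving s && order_preserving (s^-1)%g].

Fact poset_aut_group_set : group_set poset_aut.
Proof.
apply/group_setP; split.
  rewrite inE invg1 andbb; apply/order_preservingP => x y.
  by rewrite !perm1.
move=> s t; rewrite !inE => /andP[/order_preservingP Hs /order_preservingP Hsi].
move=> /andP[/order_preservingP Ht /order_preservingP Hti].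
apply/andP; split; apply/order_preservingP => x y xy; rewrite ?invMg !permM.
  exact/Ht/Hs.
exact/Hsi/Hti.
Qed.

Canonical poset_aut_group := Group poset_aut_group_set.

End PosetAut.

Arguments poset_aut {d} P.

Section Beta.
Variables (gT : finGroupType) (G : {group gT}).

Definition poset_realizable (n : nat) : Prop :=
  exists (d : Order.disp_t) (P : finPOrderType d),
    [/\ 0 < #|P|, #|P| = n & poset_aut P \isog G].

Definition is_min_poset_size (n : nat) : Prop :=
  poset_realizable n /\ forall m, poset_realizable m -> n <= m.

(* The minimum is unique when it exists.  The default value 0 would only be
   returned if no poset realized G; it is never the size of a non-empty poset,
   so beta = n with 0 < n does assert that n is the minimum (see betaP). *)
Definition beta : nat := xget 0 [set n | is_min_poset_size n]%classic.

Lemma betaP (n : nat) : 0 < n -> beta = n <-> is_min_poset_size n.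
Proof.
move=> n_gt0; split=> [|[Rn min_n]].
  rewrite /beta; case: xgetP => [m _ /= Hm <- //|_ n0].
  by rewrite -n0 in n_gt0.
apply: xget_unique => // m [Rm min_m]; apply/eqP.
by rewrite eqn_leq min_m // min_n.
Qed.

End Beta.

(* Main.v *)
Require Import Defs.
From mathcomp Require Import all_boot all_order all_fingroup all_algebra.
From HB Require Import structures.
From mathcomp Require Import all_solvable zify.

Set Implicit Arguments.
Unset Strict Implicit.
Unset Printing Implicit Defensive.

(** Both equalities are instances of one fact: an elementary abelian 2-group of
    rank [k] (for [k] = 2 and 3) is the automorphism group of a poset on [2k]
    points, and of no smaller one.

    Upper bound.  Stack [k] antichains of two points, every point of a layer
    lying below every point of the layers above it.  An automorphism preserves
    the height of a point, hence each layer, and it may swap the two points of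
    any layer independently of the others, so the automorphism group is a
    product of [k] copies of the group of order 2 ([tower_aut_abelem],
    [card_tower_aut]).

    Lower bound.  The order relation plays no part: an abelian 2-group [G] of
    permutations of [n] points satisfies [#|G| ^ 2 <= 2 ^ n]
    ([abelian_2group_perm_on_bound]), so a group of order [2 ^ k] needs
    [2k] points.  The reason is that in an abelian group the stabiliser of
    a point fixes the whole orbit of that point.  Removing an orbit of [q]
    points therefore divides the order of the group by exactly [q], and
    [q ^ 2 <= 2 ^ q] as soon as [q] is a power of 2. *)

Lemma sqr_le_exp2 q : q != 3 -> q ^ 2 <= 2 ^ q.
Proof.
case: q => [|[|[|[|q]]]] // _; elim: q => // q IHq.
rewrite expnS; apply: leq_trans (leq_mul (leqnn 2) IHq).
rewrite -!mulnn; nia.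
Qed.

(** The permutations are only required to live on a subset [A], because the
    induction passes from [G] to the stabiliser of a point, which lives on the
    complement of the orbit of that point. *)
Lemma abelian_2group_perm_on_bound (T : finType) (A : {set T})
    (G : {group {perm T}}) :
  abelian G -> 2.-group%g G -> {in G, forall s, perm_on A s} ->
  #|G| ^ 2 <= 2 ^ #|A|.
Proof.
have [n] := ubnP #|A|; elim: n A G => // n IHn A G leAn abG pG onA.
have [A0|[x xA]] := set_0Vmem A.
  suff -> : G :=: 1%g by rewrite cards1 expn_gt0.
  apply/trivgP/subsetP=> s /onA onAs; rewrite inE; apply/eqP/permP=> y.
  by rewrite perm1 (out_perm onAs) // A0 inE.
pose O := orbit 'P G x; pose H := 'C_G[x | 'P]%G.
have OA : O \subset A.
  by apply/subsetP=> _ /orbitP[s /onA onAs <-]; rewrite perm_closed.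
have xO : x \in O by apply: orbit_refl.
have HG : H \subset G := subsetIl _ _.
have onAO : {in H, forall s, perm_on (A :\: O) s}.
  move=> s Hs; have Gs := subsetP HG s Hs; have sx : s x = x.
    by case/setIP: Hs => _ /astab1P.
  apply/subsetP=> y; rewrite inE => sy.
  rewrite inE (subsetP (onA s Gs)) // andbT.
  apply: contraNN sy => /orbitP[t Gt <-] /=.
  (* [s] commutes with [t] and fixes [x], so it fixes [t x]. *)
  by rewrite apermE -permM -(centsP abG s Gs t Gt) permM sx.
have ltAO : #|A :\: O| < n.
  rewrite ltnS in leAn; apply: leq_trans leAn; apply: proper_card.
  rewrite properEneq subsetDl andbT.
  by apply: contraTneq xA => <-; rewrite inE xO.
have {IHn} IH := IHn _ _ ltAO (abelianS HG abG) (pgroupS HG pG) onAO.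
rewrite -(card_orbit_stab 'P G x) expnMn.
have -> : #|A| = #|O| + #|A :\: O|.
  by rewrite -(cardsID O A) (setIidPr OA).
rewrite expnD leq_mul //; apply: sqr_le_exp2.
apply: contraTneq pG => O3; apply/negP=> pG.
by have := pnat_dvd (dvdn_orbit 'P G x) pG; rewrite O3.
Qed.

Lemma abelem2_realizable_bound (gT : finGroupType) (G : {group gT}) k n :
  2.-abelem%g G -> #|G| = 2 ^ k -> poset_realizable G n -> k.*2 <= n.
Proof.
move=> /abelem_abelian abG cardG [d [P [_ <- isoG]]].
have abP : abelian (poset_aut P) by rewrite (isog_abelian isoG).
have pP : 2.-group%g (poset_aut P).
  by rewrite /pgroup (card_isog isoG) cardG pnatX.
have := @abelian_2group_perm_on_bound P [set: P] (poset_aut_group P) abP pP.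
rewrite /= (card_isog isoG) cardG cardsT -expnM muln2 leq_exp2l //; apply.
by move=> s _; apply/subsetP=> x; rewrite inE.
Qed.

(** A type of its own, so that the order is attached to it rather than to every
    product of the form ['I_k * bool].  The first component of a point is its
    layer. *)
Definition tower (k : nat) : Type := ('I_k * bool)%type.

HB.instance Definition _ k := Finite.on (tower k).

Section Tower.
Variable k : nat.
Implicit Types (x y : tower k) (f g : {ffun 'I_k -> bool}).

Definition tower_le x y := (x == y) || (x.1 < y.1).

Lemma tower_le_refl : reflexive tower_le.
Proof. by move=> x; rewrite /tower_le eqxx. Qed.

Lemma tower_le_anti : antisymmetric tower_le.
Proof.
move=> x y /andP[/orP[/eqP//|xy] /orP[/eqP//|yx]].
by have := ltn_trans xy yx; rewrite ltnn.
Qed.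

Lemma tower_le_trans : transitive tower_le.
Proof.
move=> y x z /orP[/eqP->//|xy] /orP[/eqP<-|yz].
  by rewrite /tower_le xy orbT.
by rewrite /tower_le (ltn_trans xy yz) orbT.
Qed.

HB.instance Definition _ := Order.Le_isPOrder.Build (Order.Disp tt tt)
  (tower k) tower_le_refl tower_le_anti tower_le_trans.

Lemma card_tower : #|{: tower k}| = k.*2.
Proof. by rewrite card_prod card_ord card_bool muln2. Qed.

Lemma tower_leE x y : (x <= y)%O = (x == y) || (x.1 < y.1).
Proof. by []. Qed.

Lemma poset_autE s : s \in poset_aut (tower k) ->
  forall x y, (s x <= s y)%O = (x <= y)%O.
Proof.
rewrite inE => /andP[/order_preservingP homs /order_preservingP homsV] x y.
by apply/idP/idP=> [/homsV|/homs//]; rewrite !permK.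
Qed.

(** Below a point of layer [i] there is a chain of [i] points, one per layer;
    its image is a chain of [i] points below the image point, which therefore
    lies in layer [i] or higher. *)
Lemma tower_aut_layer_ge s x : s \in poset_aut (tower k) -> x.1 <= (s x).1.
Proof.
move=> /poset_autE mono_s; case: x => [[i lti] b] /=.
elim: i lti b => // i IHi lti b.
pose y : tower k := (Ordinal (ltnW lti), b); apply: leq_ltn_trans (IHi (ltnW lti) b) _.
pose x : tower k := (Ordinal lti, b); have yx : y != x by apply/eqP=> -[]; lia.
have := mono_s y x; rewrite !tower_leE (inj_eq perm_inj) (negPf yx) /= ltnSn.
exact.
Qed.

(** The bound for [s^-1] at the point [s x] is the converse inequality. *)
Lemma tower_aut_layer s x : s \in poset_aut (tower k) -> (s x).1 = x.1.
Proof.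
move=> auts; apply/val_inj/eqP; rewrite eqn_leq tower_aut_layer_ge // andbT.
by have := tower_aut_layer_ge (s x) (groupVr auts); rewrite permK.
Qed.

Definition swap_fun f x : tower k := (x.1, x.2 (+) f x.1).

Lemma swap_funK f : involutive (swap_fun f).
Proof. by case=> i b; rewrite /swap_fun /= addbK. Qed.

Definition swap f : {perm tower k} := perm (inv_inj (swap_funK f)).

Lemma swapE f x : swap f x = swap_fun f x. Proof. exact: permE. Qed.

Lemma swap_inj : injective swap.
Proof.
move=> f g fg; apply/ffunP=> i.
by have /permP/(_ (i, false)) := fg; rewrite !swapE => -[].
Qed.

Lemma swapV f : (swap f)^-1%g = swap f.
Proof.
apply/permP=> x; apply: (@perm_inj _ (swap f)).
by rewrite permKV !swapE swap_funK.
Qed.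

Lemma poset_aut_tower :
  poset_aut (tower k) = [set swap f | f : {ffun 'I_k -> bool}].
Proof.
apply/setP=> s; apply/idP/imsetP=> [auts|[f _ ->]].
  exists [ffun i => (s (i, false)).2] => //; apply/permP=> -[i b].
  rewrite swapE /swap_fun /= ffunE.
  have si c : s (i, c) = (i, (s (i, c)).2).
    by rewrite [LHS]surjective_pairing (tower_aut_layer _ auts).
  case: b; rewrite si //.
  (* [s] is injective on the layer, so it moves both of its points or none. *)
  have : s (i, true) <> s (i, false) by move=> /perm_inj-[].
  rewrite (si true) (si false) /=.
  by case: (s (i, true)).2; case: (s (i, false)).2; rewrite /=.
have homf : order_preserving (swap f).
  apply/order_preservingP=> x y; rewrite !tower_leE !swapE.
  by case/orP=> [/eqP->|xy]; rewrite ?eqxx //= xy orbT.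
by rewrite inE swapV homf.
Qed.

Lemma card_tower_aut : #|poset_aut (tower k)| = 2 ^ k.
Proof.
rewrite poset_aut_tower (card_imset _ swap_inj).
by rewrite card_ffun card_bool card_ord.
Qed.

Lemma tower_aut_abelem : 2.-abelem%g (poset_aut (tower k)).
Proof.
apply/abelemP=> //; split.
  rewrite /= poset_aut_tower.
  apply/centsP=> _ /imsetP[f _ ->] _ /imsetP[g _ ->].
  by apply/permP=> x; rewrite !permM !swapE /swap_fun /= addbAC.
move=> s; rewrite /= poset_aut_tower => /imsetP[f _ ->].
by rewrite expgS expg1 -{1}swapV mulVg.
Qed.

End Tower.

(** Elementary abelian 2-groups are determined up to isomorphism by their order,
    so the automorphism group of the tower need not be matched with [G] by an
    explicit map. *)
Lemma abelem2_beta (gT : finGroupType) (G : {group gT}) k :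
  0 < k -> 2.-abelem%g G -> #|G| = 2 ^ k -> beta G = k.*2.
Proof.
move=> k_gt0 abelG cardG; apply/betaP; first by rewrite double_gt0.
split=> [|m]; last exact: abelem2_realizable_bound.
exists _, (tower k); split; rewrite ?card_tower ?double_gt0 //.
by rewrite (isog_abelem_card _ (tower_aut_abelem k)) abelG cardG card_tower_aut /=.
Qed.

Lemma abelem2_setX (gT rT : finGroupType) :
  2.-abelem%g [set: gT] -> 2.-abelem%g [set: rT] -> 2.-abelem%g [set: gT * rT].
Proof.
move=> /(abelemP (isT : prime 2))[abg g2] /(abelemP (isT : prime 2))[abr r2].
apply/abelemP=> //; split.
  apply/centsP=> -[a b] _ [c d] _; congr pair.
    by apply: (centsP abg); rewrite inE.
  by apply: (centsP abr); rewrite inE.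
case=> a b _; rewrite expgS expg1; congr pair.
  by rewrite -(g2 a) ?inE // expgS expg1.
by rewrite -(r2 b) ?inE // expgS expg1.
Qed.

Lemma abelem2_Z2 : 2.-abelem%g [set: 'Z_2].
Proof. by rewrite prime_abelem // cardsT card_ord. Qed.

Theorem proposition1p2 :
  beta [set: 'Z_2 * 'Z_2]%G = 4 /\ beta [set: 'Z_2 * 'Z_2 * 'Z_2]%G = 6.
Proof.
split.
  apply: (@abelem2_beta _ _ 2) => //; last by rewrite cardsT !card_prod card_ord.
  exact/abelem2_setX/abelem2_Z2/abelem2_Z2.
apply: (@abelem2_beta _ _ 3) => //; last by rewrite cardsT !card_prod card_ord.
exact/abelem2_setX/abelem2_Z2/abelem2_setX/abelem2_Z2/abelem2_Z2.
Qed.
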